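(* Let $q\in W$, $t>0$, let $y_\star$ be the unique minimizer of $\Psi_{q,t}$, and let $(y,\mu)\in W\times X^*$ have a finite gap. Then $$\frac{\|y-y_\star\|_W^2}{2t}+\frac{\|q-t\mathcal R_W^{-1}T^*\mu-y_\star\|_W^2}{2t}\le\mathcal G_{q,t}(y,\mu).$$ In particular, if $y=q-t\mathcal R_W^{-1}T^*\mu$, then $$\|y-y_\star\|_W^2\le t\,\mathcal G_{q,t}(y,\mu).$$ These inequalities do not require dual attainment. If there is a dual vector $\mu_\star\in X^*$ such that $\mathcal G_{q,t}(y_\star,\mu_\star)=0$, then the following exact identity holds: $$\begin{aligned}\mathcal G_{q,t}(y,\mu)={}&\frac{\|y-y_\star\|_W^2}{2t}+\frac t2\|T^*(\mu-\mu_\star)\|_{W^*}^2\\&+\bigl[R(Ty)-R(Ty_\star)-\langle\mu_\star,T(y-y_\star)\rangle\bigr]\\&+\bigl[R^*(\mu)-R^*(\mu_\star)-\langle\mu-\mu_\star,Ty_\star\rangle\bigr],\end{aligned}$$ and each of the two bracketed remainders is nonnegative.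
   Context: $W$ is a real Hilbert space with inner product $(\cdot,\cdot)_W$; $X$ is a real Banach space with continuous dual $X^*$; $T:W\to X$ is bounded and linear with Banach adjoint $T^*:X^*\to W^*$. $\mathcal R_W:W\to W^*$ is the Riesz map $\langle\mathcal R_Wu,v\rangle=(u,v)_W$ and $\|\ell\|_{W^*}=\|\mathcal R_W^{-1}\ell\|_W$. $R:X\to(-\infty,+\infty]$ is proper, convex, norm lower semicontinuous, and $\operatorname{dom}(R\circ T)\ne\emptyset$. For $q\in W$, $t>0$: $\Psi_{q,t}(y)=\frac1{2t}\|y-q\|_W^2+R(Ty)$ (it has a unique minimizer on $W$), $D_{q,t}(\mu)=\langle\mu,Tq\rangle-\frac t2\|T^*\mu\|_{W^*}^2-R^*(\mu)$, with $R^*(\mu)=\sup_{x\in X}(\langle\mu,x\rangle-R(x))$. The gap is $\mathcal G_{q,t}(y,\mu)=\Psi_{q,t}(y)-D_{q,t}(\mu)$. A pair has finite gap when $Ty\in\operatorname{dom}R$ and $\mu\in\operatorname{dom}R^*$. ''Dual attainment'' means existence of a maximizer of $D_{q,t}$ on $X^*$ (with zero gap); it is not assumed for the first two inequalities. *)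

(* Defs.v *)
From HB Require Import structures.
From mathcomp Require Import all_boot all_order all_algebra sesquilinear.
From mathcomp Require Import all_classical all_reals all_analysis.
From mathcomp Require Import ring.

Set Implicit Arguments.
Unset Strict Implicit.
Unset Printing Implicit Defensive.

Import Order.TTheory GRing.Theory Num.Def Num.Theory.
Import numFieldNormedType.Exports.

Local Open Scope classical_set_scope.
Local Open Scope ring_scope.

(* A real Hilbert space is a Banach space whose norm comes from an inner
   product, the latter being one of the library's symmetric positive definite
   bilinear forms. *)
HB.mixin Record NormedModule_isInner (K : realType) W & NormedModule K W := {
  inner : {dot W for idfun} ;
  innerE : forall u : W, inner u u = `|u| ^+ 2
}.

#[short(type="hilbertType")]
HB.structure Definition Hilbert (K : realType) :=
  {W of CompleteNormedModule K W & NormedModule_isInner K W}.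

Section bounded_linear.
Context {K : realType} {V V' : normedModType K}.

(* For linear maps boundedness is continuity: [linear_bounded_continuous]. *)
Definition blin_pred : {pred V -> V'} :=
  mem [set f : V -> V' | linear f /\ continuous f].

Record blin := BLin { blin_fun :> V -> V' ; _ : blin_fun \in blin_pred }.

HB.instance Definition _ := [isSub for blin_fun].
HB.instance Definition _ := [Choice of blin by <:].

Lemma blin_linear (f : blin) : linear f.
Proof. by case: f => f /= /set_mem[]. Qed.

Lemma blin_continuous (f : blin) : continuous f.
Proof. by case: f => f /= /set_mem[]. Qed.

HB.instance Definition _ (f : blin) :=
  GRing.isLinear.Build K V V' _ f (blin_linear f).

Lemma blin_submod_closed : submod_closed blin_pred.
Proof.
split.
  apply/mem_set; split; last exact: cst_continuous.
  move=> a u v; change (0 = a *: 0 + 0 :> V').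
  by rewrite scaler0 addr0.
move=> a f g /set_mem[lf cf] /set_mem[lg cg]; apply/mem_set; split.
  move=> b u v.
  change (a *: f (b *: u + v) + g (b *: u + v) =
    b *: (a *: f u + g u) + (a *: f v + g v)).
  rewrite lf lg !scalerDr !scalerA (mulrC a b) !addrA; congr (_ + _).
  by rewrite addrAC.
move=> x; apply: (@continuousD _ _ _ (a \*: f) g); last exact: cg.
by apply: continuousZl_tmp; exact: cf.
Qed.

HB.instance Definition _ :=
  GRing.isSubmodClosed.Build K (V -> V') blin_pred blin_submod_closed.
HB.instance Definition _ := [SubChoice_isSubLmodule of blin by <:].

End bounded_linear.
Arguments blin {K} V V'.

Notation dual X := (blin X _^o).

Section adjoint.
Context {K : realType} {W X : normedModType K}.

Lemma adjoint_subproof (T : blin W X) (mu : dual X) :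
  (mu \o T : W -> K^o) \in blin_pred.
Proof.
apply/mem_set; split; first by move=> a u v /=; rewrite !linearP.
by move=> x; apply: continuous_comp; exact: blin_continuous.
Qed.

Definition adjoint (T : blin W X) (mu : dual X) : dual W :=
  BLin (adjoint_subproof T mu).

End adjoint.

Section riesz.
Context {K : realType} {W : hilbertType K}.

Lemma innerC (u v : W) : inner u v = inner v u.
Proof. by rewrite (@hermC _ false idfun) expr0 mul1r. Qed.

Lemma inner_polarization (u v : W) :
  inner u v = 4^-1 * (`|u + v| ^+ 2 - `|u - v| ^+ 2).
Proof.
rewrite -!innerE (@hnormD _ false idfun) (@hnormB _ false idfun)/= expr0 !mul1r.
by field.
Qed.

Lemma riesz_subproof (u : W) : (inner u : W -> K^o) \in blin_pred.
Proof.
apply/mem_set; split; first by move=> a v w; rewrite linearPr.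
move=> v.
rewrite [X in continuous_at _ X](_ : _ =
  (fun w => 4^-1 * (`|u + w| ^+ 2 - `|u - w| ^+ 2))); last first.
  by apply/funext => w; exact: inner_polarization.
have cst_u : (fun=> u) @ v --> u by exact: cvg_cst.
have cD : `|u + w| @[w --> v] --> `|u + v| by apply: cvg_norm; apply: cvgD.
have cB : `|u - w| @[w --> v] --> `|u - v| by apply: cvg_norm; apply: cvgB.
by apply: cvgM; [exact: cvg_cst|apply: cvgB; apply: cvgM].
Qed.

Definition riesz (u : W) : dual W := BLin (riesz_subproof u).

(* [riesz] is a bijection by the Riesz representation theorem, so that this
   choice of a preimage is its two-sided inverse. *)
Definition riesz_inv : dual W -> W := 'pinv_(fun=> 0) [set: W] riesz.

Definition dual_norm (l : dual W) : K := `|riesz_inv l|.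

End riesz.

Section extended_functions.
Context {K : realType} {X : normedModType K}.
Local Open Scope ereal_scope.
Implicit Type R : X -> \bar K.

Definition minimizer S (f : S -> \bar K) (y : S) := forall z, f y <= f z.

Definition edom S (f : S -> \bar K) : set S := [set x | f x < +oo].

Definition eproper R := (forall x, R x != -oo) /\ edom R !=set0.

(* At the endpoints [0 * +oo = 0] makes the inequality trivially true. *)
Definition econvex R := forall (x y : X) (s : K), (0 <= s <= 1)%R ->
  R (s *: x + (1 - s) *: y)%R <= s%:E * R x + (1 - s)%:E * R y.

Definition conjugate R (mu : dual X) : \bar K :=
  ereal_sup [set (mu x)%:E - R x | x in [set: X]].

End extended_functions.

Section primal_dual.
Context {K : realType} {W : hilbertType K} {X : completeNormedModType K}.
Variables (T : blin W X) (R : X -> \bar K) (q : W) (t : K).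
Local Open Scope ereal_scope.

Definition primal (y : W) : \bar K :=
  ((2 * t)^-1 * `|y - q| ^+ 2)%:E + R (T y).

Definition dual_obj (mu : dual X) : \bar K :=
  (mu (T q) - t / 2 * dual_norm (adjoint T mu) ^+ 2)%:E - conjugate R mu.

Definition gap (y : W) (mu : dual X) : \bar K := primal y - dual_obj mu.

End primal_dual.

(* Main.v *)
Require Import Defs.
From mathcomp Require Import all_boot all_order all_algebra sesquilinear.
From mathcomp Require Import all_classical all_reals all_analysis.
From mathcomp Require Import ring lra.

Set Implicit Arguments.
Unset Strict Implicit.
Unset Printing Implicit Defensive.

Import Order.TTheory GRing.Theory Num.Theory.
Import numFieldNormedType.Exports.

Local Open Scope classical_set_scope.
Local Open Scope ring_scope.
Local Open Scope ereal_scope.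

(** The two halves of the first inequality have different sources.  Since
    [z |-> R (T z)] is convex, the primal objective is [1/t]-strongly convex,
    so it exceeds its minimum by at least [|y - ystar|^2 / (2 t)]
    ([quadratic_growth]).  On the other side, writing [r] for the Riesz
    representative of [T^* mu], so that [mu (T z) = (r, z)], completing the
    square turns the gap into
      [|q - t r - y|^2 / (2 t) + (R (T y) + R^* mu - mu (T y))]
    at every pair with finite gap ([gapE]), where the last term is nonnegative by
    Fenchel-Young.  Taking [y := ystar] bounds the gap at [(ystar, mu)] from
    below by the second square, and adding the excess of the primal objective
    at [y] over its minimum gives the claim.  When [y = q - t r] the two
    squares coincide, hence the constant [t] in the second inequality.

    If the gap vanishes at [(ystar, mustar)], both nonnegative terms of the
    decomposition vanish: [q = ystar + t rstar], and Fenchel-Young is an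
    equality at [(T ystar, mustar)] ([zero_gap]).  Substituting this value of
    [q] in the decomposition at [(y, mu)] and expanding the square gives the
    identity, the cross term [(r - rstar, y - ystar)] being what separates
    the Fenchel-Young slack of [(T y, mu)] from the sum of the two bracketed
    remainders.

    The map [riesz_inv] is only chosen as a partial inverse, so all of this
    rests on the surjectivity of the Riesz map ([riesz_surj]): the energy
    [|v|^2 / 2 - l v] is bounded below, its minimizing sequences are Cauchy by
    the midpoint identity, and quadratic growth at the limit yields
    [l = (v, .)]. *)

(** * Squared norms in a Hilbert space *)

Section hilbert_geometry.
Context {K : realType} {W : hilbertType K}.
Local Open Scope ring_scope.
Implicit Types u v w : W.

Lemma normD_sqr u v : `|u + v| ^+ 2 = `|u| ^+ 2 + 2 * inner u v + `|v| ^+ 2.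
Proof.
by rewrite -!innerE (@hnormD _ false idfun) /= expr0 mul1r; ring.
Qed.

Lemma normB_sqr u v : `|u - v| ^+ 2 = `|u| ^+ 2 - 2 * inner u v + `|v| ^+ 2.
Proof.
by rewrite -!innerE (@hnormB _ false idfun) /= expr0 mul1r; ring.
Qed.

Lemma normZ_sqr (a : K) u : `|a *: u| ^+ 2 = a ^+ 2 * `|u| ^+ 2.
Proof. by rewrite normrZ exprMn real_normK// num_real. Qed.

Lemma innerZl (a : K) u v : inner (a *: u) v = a * inner u v.
Proof. by rewrite linearZl_LR. Qed.

Lemma innerZr (a : K) u v : inner u (a *: v) = a * inner u v.
Proof. by rewrite linearZr_LR. Qed.

Lemma innerBl u v w : inner (u - v) w = inner u w - inner v w.
Proof. exact: linearBl. Qed.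

Lemma norm_convex_comb_sqr (s : K) u v :
  `|s *: u + (1 - s) *: v| ^+ 2 =
  s * `|u| ^+ 2 + (1 - s) * `|v| ^+ 2 - s * (1 - s) * `|u - v| ^+ 2.
Proof. by rewrite normB_sqr normD_sqr !normZ_sqr innerZl innerZr; ring. Qed.

End hilbert_geometry.

(** * Quadratic growth at a minimizer *)

Section growth.
Context {K : realType} {W : hilbertType K}.
Local Open Scope ring_scope.

(** The limit [s -> 0], without limits.  The case [s = 1] forces [0 <= d], and
    if [d < c] the weight below turns the hypothesis into
    [(c + d) / 2 <= d]. *)
Lemma le_of_scaled (c d : K) :
  (forall s, 0 < s <= 1 -> (1 - s) * c <= d) -> c <= d.
Proof.
move=> H; have d_ge0 : 0 <= d by have := H 1; rewrite subrr mul0r; apply; lra.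
rewrite leNgt; apply/negP => ltdc.
have c_gt0 : 0 < c by exact: le_lt_trans ltdc.
have /H : 0 < (c - d) / (2 * c) <= 1.
  by rewrite divr_gt0/= ?ler_pdivrMr; lra.
have -> : (1 - (c - d) / (2 * c)) * c = (c + d) / 2 by field; lra.
lra.
Qed.

(** Compare the minimum with the value at [s x + (1 - s) x0]: strong convexity
    of the quadratic term gains [s (1 - s) |x - x0|^2 / (2 t)]; divide by [s]
    and let [s -> 0]. *)
Lemma quadratic_growth (g : W -> \bar K) (q : W) (t : K) (x0 x : W) :
  econvex g -> (forall z, g z != -oo)%E -> 0 < t ->
  minimizer (fun z => ((2 * t)^-1 * `|z - q| ^+ 2)%:E + g z)%E x0 ->
  g x0 \is a fin_num -> g x \is a fin_num ->
  (2 * t)^-1 * `|x0 - q| ^+ 2 + fine (g x0) + (2 * t)^-1 * `|x - x0| ^+ 2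
  <= (2 * t)^-1 * `|x - q| ^+ 2 + fine (g x).
Proof.
move=> g_cvx gNy t_gt0 x0_min.
case gx0E : (g x0) => [a| |] // _; case gxE : (g x) => [b| |] // _ /=.
rewrite -lerBrDl; apply: le_of_scaled => s /andP[s_gt0 s_le1].
have := g_cvx x x0 s; rewrite s_le1 ltW// => /(_ isT).
have := x0_min (s *: x + (1 - s) *: x0).
have := gNy (s *: x + (1 - s) *: x0).
case: (g _) => [c| |] // _; last by rewrite gx0E gxE.
rewrite gx0E gxE -!EFinM -!EFinD !lee_fin.
have -> : s *: x + (1 - s) *: x0 - q = s *: (x - q) + (1 - s) *: (x0 - q).
  rewrite !scalerBr addrACA -opprD -scalerDl.
  by rewrite [(s + _)%R]addrC subrK scale1r.
rewrite norm_convex_comb_sqr.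
have -> : x - q - (x0 - q) = x - x0 by rewrite opprB addrA subrK.
move: (`|x - q| ^+ 2) (`|x0 - q| ^+ 2) (`|x - x0| ^+ 2) => A B C.
set k := (2 * t)^-1 => le1 le2; rewrite -(ler_pM2l s_gt0); lra.
Qed.

End growth.

(** * The Riesz representation theorem *)

(* Elements of the dual take values in [K^o]; these restatements of linearity
   have their values, and the scaling, in [K] itself, where the arithmetic
   tactics apply. *)
Section dual_pairing.
Context {K : realType} {V : normedModType K}.
Local Open Scope ring_scope.
Implicit Types (l : dual V) (u v : V).

Lemma dualD l u v : l (u + v) = l u + l v :> K.
Proof. exact: linearD. Qed.

Lemma dualN l u : l (- u) = - l u :> K.
Proof. exact: linearN. Qed.

Lemma dualB l u v : l (u - v) = l u - l v :> K.
Proof. exact: linearB. Qed.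

Lemma dualZ l (a : K) u : l (a *: u) = a * l u :> K.
Proof. exact: linearZ. Qed.

End dual_pairing.

Section riesz_representation.
Context {K : realType} {W : hilbertType K}.
Local Open Scope ring_scope.
Implicit Types (l : dual W) (u v : W).

(* The shape of the primal objective with [t = 1] and [q = 0], so that
   [quadratic_growth] applies to it. *)
Let J l v : K := (2 * 1)^-1 * `|v - 0| ^+ 2 - l v.

Lemma energy_bounded_below l : exists M, forall v, M <= J l v.
Proof.
have /linear_boundedP/pinfty_ex_gt0[C C_gt0 lC] : bounded_near l (nbhs 0).
  by apply: (@continuous_linear_bounded _ _ _ 0 l); exact: blin_continuous.
(* [- C |v|] is absorbed by [(|v| - C)^2 >= 0]. *)
exists (- (C ^+ 2 / 2)) => v; rewrite /J subr0.
have := le_trans (ler_norm (l v)) (lC v).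
have := sqr_ge0 (`|v| - C).
move: `|v| (l v : K) => a b; nra.
Qed.

(** Points of almost minimal energy are close to each other, because their
    midpoint cannot do better than the infimum. *)
Lemma energy_midpoint l u v :
  J l (2^-1 *: u + (1 - 2^-1) *: v) =
  (J l u + J l v) / 2 - `|u - v| ^+ 2 / 8.
Proof.
by rewrite /J !subr0 norm_convex_comb_sqr dualD !dualZ; field.
Qed.

Lemma energy_minimizer l : exists v, forall u, J l v <= J l u.
Proof.
have [M MJ] := energy_bounded_below l.
set A := range (J l).
have infA : has_inf A.
  by split; [exists (J l 0), 0 | exists M => _ [v _ <-]].
set m := inf A.
have mJ v : m <= J l v by apply: ge_inf; [exact: infA.2 | exists v].
have /choice[u Ju] : forall n, exists v, J l v < m + n.+1%:R^-1.
  move=> n; have e_gt0 : 0 < n.+1%:R^-1 :> K by rewrite invr_gt0.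
  by have [_ [v _ <-] ?] := inf_adherent e_gt0 infA; exists v.
have u_cvg : cvg (u @ \oo).
  apply/cauchy_cvgP/cauchy_exP => _/posnumP[e].
  have e_gt0 : 0 < e%:num ^+ 2 / 8 by rewrite divr_gt0// exprn_gt0.
  have [N _ HN] := near_infty_natSinv_lt (PosNum e_gt0).
  (* By the midpoint identity an eighth of the squared distance is at most the
     mean of the two excesses over the infimum. *)
  exists (u N); exists N => // n /= Nn.
  have invN : (N.+1%:R^-1 : K) < e%:num ^+ 2 / 8 := HN _ (leqnn N).
  have invn : (n.+1%:R^-1 : K) < e%:num ^+ 2 / 8 := HN _ Nn.
  have := mJ (2^-1 *: u N + (1 - 2^-1) *: u n).
  rewrite energy_midpoint => mid.
  have JuN := Ju N; have Jun := Ju n.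
  have : `|u N - u n| ^+ 2 < e%:num ^+ 2 :> K.
    move: (n.+1%:R^-1 : K) (N.+1%:R^-1 : K) invn invN mid JuN Jun => a b.
    lra.
  by rewrite -ball_normE /= ltr_pXn2r// nnegrE.
have cvgJ : J l (u n) @[n --> \oo] --> J l (lim (u @ \oo)).
  apply: cvgB; last by apply: continuous_cvg => //; exact: blin_continuous.
  apply: cvgM; first exact: cvg_cst.
  have c : `|u n - 0| @[n --> \oo] --> `|lim (u @ \oo) - 0|.
    by apply: cvg_norm; apply: cvgB => //; exact: cvg_cst.
  by apply: cvgM.
exists (lim (u @ \oo)) => v; apply: le_trans (mJ v).
have cvgm : m + n.+1%:R^-1 @[n --> \oo] --> m.
  rewrite -[X in _ --> X]addr0.
  by apply: cvgD; [exact: cvg_cst | exact: cvg_harmonic].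
by apply: ler_cvg_to cvgJ cvgm _; near=> n; exact: ltW.
Unshelve. all: by end_near. Qed.

(** Growth at the minimizer [v] of the energy, tested at [v + u], reads
    [l u <= (v, u)]; replacing [u] by [- u] gives equality. *)
Lemma riesz_surj l : exists v, riesz v = l.
Proof.
have [v v_min] := energy_minimizer l.
suff le_vl u : l u <= inner v u.
  exists v; apply/val_inj/funext => u /=; apply/le_anti; rewrite le_vl andbT.
  have := le_vl (- u); rewrite linearNr dualN.
  by rewrite lerN2.
have g_cvx : econvex (fun w => (- l w)%:E).
  move=> x y s _; rewrite -!EFinM -EFinD lee_fin dualD !dualZ; lra.
have v_min' : minimizer
    (fun w => ((2 * 1)^-1 * `|w - 0| ^+ 2)%:E + (- l w)%:E)%E v.
  by move=> w; rewrite -!EFinD lee_fin; exact: v_min.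
have := quadratic_growth (x := v + u) g_cvx (fun=> isT) ltr01 v_min' isT isT.
rewrite /= !subr0 [(v + u - v)%R]addrAC subrr add0r normD_sqr dualD.
lra.
Qed.

Lemma riesz_invK : cancel riesz_inv (@riesz K W).
Proof.
move=> l; have [v <-] := riesz_surj l.
by apply: pinvK; apply/mem_set; exists v.
Qed.

Lemma riesz_inj : injective (@riesz K W).
Proof.
move=> u v uv; apply/eqP; rewrite -subr_eq0 -normr_eq0 -sqrf_eq0.
rewrite -innerE innerBl subr_eq0.
by have /(congr1 (fun l : dual W => l (u - v))) /= -> := uv.
Qed.

Lemma inner_riesz_inv l u : inner (riesz_inv l) u = l u.
Proof. exact: (congr1 (fun l : dual W => l u) (riesz_invK l)). Qed.

Lemma riesz_invB l m : riesz_inv (l - m) = riesz_inv l - riesz_inv m.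
Proof.
apply: riesz_inj; rewrite riesz_invK; apply/val_inj/funext => u /=.
by rewrite innerBl !inner_riesz_inv.
Qed.

End riesz_representation.

(** * The Fenchel-Young inequality *)

Section fenchel_young.
Context {K : realType} {X : normedModType K}.
Variable R : X -> \bar K.

Lemma conjugate_ge (mu : dual X) (x : X) : (mu x)%:E - R x <= conjugate R mu.
Proof. by apply: ereal_sup_ubound; exists x. Qed.

Lemma conjugate_neqNy (mu : dual X) : eproper R -> conjugate R mu != -oo.
Proof.
case=> RNy [x Rx]; rewrite -ltNye; apply: lt_le_trans (conjugate_ge mu x).
move: Rx (RNy x); rewrite /edom /=.
by case: (R x) => [r| |] // _ _; exact: ltNyr.
Qed.

Lemma fenchel_young (mu : dual X) (x : X) (a c : K) :
  R x = a%:E -> conjugate R mu = c%:E -> (mu x <= a + c)%R.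
Proof.
by move=> Rx Rmu; have := conjugate_ge mu x; rewrite Rx Rmu lee_fin lerBlDl.
Qed.

End fenchel_young.

(** * Decomposition of the primal-dual gap *)

Section gap_decomposition.
Context {K : realType} {W : hilbertType K} {X : completeNormedModType K}.
Variables (T : blin W X) (R : X -> \bar K) (q : W) (t : K).
Local Notation r mu := (riesz_inv (adjoint T mu)).

Lemma inner_adjoint (mu : dual X) (w : W) : inner (r mu) w = mu (T w).
Proof. exact: inner_riesz_inv. Qed.

Lemma econvex_comp : econvex R -> econvex (R \o T).
Proof.
by move=> R_cvx x y s s01; rewrite /= linearD !linearZ; exact: R_cvx.
Qed.

(** The gap is a square measuring the failure of [y = q - t r] plus the
    Fenchel-Young slack measuring the failure of [mu] to be a subgradient of
    [R] at [T y]. *)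
Lemma gapE (y : W) (mu : dual X) (a c : K) :
  (0 < t)%R -> R (T y) = a%:E -> conjugate R mu = c%:E ->
  gap T R q t y mu =
  (`|q - t *: r mu - y| ^+ 2 / (2 * t) + (a + c - mu (T y)))%:E.
Proof.
move=> t_gt0 Ra Rc; rewrite /gap /primal /dual_obj Ra Rc.
rewrite -(EFinD _ a) -(EFinB _ c) -EFinB; congr _%:E.
rewrite [(q - _ - y)%R]addrAC (normB_sqr (q - y)%R) normZ_sqr innerZr innerBl.
rewrite -!inner_adjoint.
rewrite /dual_norm [`|y - q|%R]distrC !(innerC (r mu)).
by field; exact: lt0r_neq0.
Qed.

(** A vanishing gap forces both terms of [gapE] to vanish, which gives the
    optimality conditions of the pair. *)
Lemma zero_gap (y : W) (mu : dual X) (a : K) :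
  (0 < t)%R -> R (T y) = a%:E -> gap T R q t y mu = 0 ->
  exists c, [/\ conjugate R mu = c%:E, (q = y + t *: r mu)%R
    & (mu (T y) = a + c)%R].
Proof.
move=> t_gt0 Ra gap0; have [c Rc] : exists c, conjugate R mu = c%:E.
  move: gap0; rewrite /gap /primal /dual_obj Ra.
  case: (conjugate R mu) => [c _||//]; first by exists c.
  by rewrite /= addey.
exists c; have FY := fenchel_young Ra Rc.
move: gap0; rewrite (gapE t_gt0 Ra Rc) => -[] gap0.
have sq_ge0 : (0 <= `|q - t *: r mu - y| ^+ 2 / (2 * t))%R.
  by rewrite divr_ge0// ?exprn_ge0//; lra.
split=> //; last lra.
have : (`|q - t *: r mu - y| ^+ 2 / (2 * t) == 0)%R by apply/eqP; lra.
rewrite mulf_eq0 invr_eq0 => /orP[|/eqP t_eq0]; last by exfalso; lra.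
rewrite sqrf_eq0 normr_eq0 subr_eq0 => /eqP <-.
by rewrite subrK.
Qed.

End gap_decomposition.

(** * Gap estimates *)

Theorem proposition3p2 (K : realType) (W : hilbertType K)
    (X : completeNormedModType K) (T : blin W X) (R : X -> \bar K)
    (R_proper : eproper R) (R_convex : econvex R)
    (R_lsc : lower_semicontinuous R) (domRT : edom (R \o T) !=set0)
    (q : W) (t : K) (t_gt0 : (0 < t)%R)
    (ystar : W) (ystar_min : minimizer (primal T R q t) ystar)
    (y : W) (mu : dual X)
    (dom_y : edom R (T y)) (dom_mu : edom (conjugate R) mu) :
  [/\ (`|y - ystar| ^+ 2 / (2 * t)
         + `|q - t *: riesz_inv (adjoint T mu) - ystar| ^+ 2 / (2 * t))%:E
        <= gap T R q t y mu,
      y = (q - t *: riesz_inv (adjoint T mu))%R ->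
        (`|y - ystar| ^+ 2)%:E <= t%:E * gap T R q t y mu
    & forall mustar : dual X, gap T R q t ystar mustar = 0 ->
        [/\ gap T R q t y mu =
              (`|y - ystar| ^+ 2 / (2 * t)
                 + t / 2 * dual_norm (adjoint T (mu - mustar)%R) ^+ 2)%:E
              + (R (T y) - R (T ystar) - (mustar (T (y - ystar)%R))%:E)
              + (conjugate R mu - conjugate R mustar
                   - ((mu - mustar)%R (T ystar))%:E),
            0 <= R (T y) - R (T ystar) - (mustar (T (y - ystar)%R))%:E
          & 0 <= conjugate R mu - conjugate R mustar
                   - ((mu - mustar)%R (T ystar))%:E]].
Proof.
have [RNy _] := R_proper.
have fin_R x : R x < +oo -> exists a, R x = a%:E.
  by move: (RNy x); case: (R x) => [a| |] // _ _; exists a.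
have [a Ra] := fin_R _ dom_y.
have [b Rb] : exists b, R (T ystar) = b%:E.
  apply: fin_R; have := ystar_min y; rewrite /primal Ra -EFinD.
  move=> /le_lt_trans/(_ (ltry _)); case: (R (T ystar)) => [b _|/=|_].
  - exact: ltry.
  - by rewrite ltxx.
  - by [].
have [c Rc] : exists c, conjugate R mu = c%:E.
  move: dom_mu (conjugate_neqNy mu R_proper); rewrite /edom /=.
  by case: (conjugate R mu) => [c| |] // _ _; exists c.
have growth := quadratic_growth (x := y) (econvex_comp T R_convex)
  (fun z => RNy (T z)) t_gt0 ystar_min.
rewrite /= Ra Rb /= in growth; have {}growth := growth isT isT.
(* The gap at [(y, mu)] is the primal excess of [y] plus the gap at
   [(ystar, mu)]. *)
have gap_le : (`|y - ystar| ^+ 2 / (2 * t)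
    + `|q - t *: riesz_inv (adjoint T mu) - ystar| ^+ 2 / (2 * t))%:E
      <= gap T R q t y mu.
  have -> : gap T R q t y mu = ((2 * t)^-1 * `|y - q| ^+ 2 + a
      - ((2 * t)^-1 * `|ystar - q| ^+ 2 + b))%:E + gap T R q t ystar mu.
    rewrite /gap /primal /dual_obj Ra Rb Rc -!EFinD; congr _%:E; ring.
  rewrite (gapE q t_gt0 Rb Rc) -EFinD lee_fin.
  have := fenchel_young Rb Rc; lra.
split=> //.
  move=> yE; move: gap_le; rewrite -yE (gapE q t_gt0 Ra Rc) -EFinM !lee_fin.
  rewrite -(ler_pM2l t_gt0); apply: le_trans; rewrite le_eqVlt; apply/orP; left.
  by apply/eqP; field; lra.
move=> mustar gap0.
have [d [Rd qE bdE]] := zero_gap t_gt0 Rb gap0.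
have FY := fenchel_young Rb Rd.
rewrite Ra Rb Rc Rd.
have -> : (mustar (T (y - ystar)) = mustar (T y) - mustar (T ystar) :> K)%R.
  by rewrite linearB dualB.
have dmuE x : ((mu - mustar) x = mu x - mustar x :> K)%R by [].
rewrite dmuE.
rewrite -!EFinB -!EFinD !lee_fin; split; first last.
- by have := fenchel_young Rb Rc; lra.
- by have := fenchel_young Ra Rd; lra.
rewrite (gapE q t_gt0 Ra Rc); congr _%:E.
(* The square of [gapE], recentred at the optimal pair. *)
rewrite qE.
have -> : (ystar + t *: riesz_inv (adjoint T mustar)
      - t *: riesz_inv (adjoint T mu) - y =
    (ystar - y) - t *: riesz_inv (adjoint T (mu - mustar)))%R.
  have -> : (adjoint T (mu - mustar) = adjoint T mu - adjoint T mustar)%R.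
    exact/val_inj.
  rewrite riesz_invB scalerBr opprB -!addrA; congr (_ + _)%R.
  by rewrite [RHS]addrC -addrA.
rewrite (normB_sqr (ystar - y)%R) normZ_sqr innerZr innerC inner_adjoint.
rewrite linearB dualB /dual_norm distrC.
rewrite !dmuE bdE.
by field; exact: lt0r_neq0.
Qed.
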